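(* Let $X_1,\ldots,X_n$ be i.i.d. random variables taking values in $[0,1]$ with mean $\mu\in(0,1)$ and variance $\sigma^2>0$. Let $\overline X=\frac1n\sum_{i=1}^nX_i$, $\overline V=\frac1n\sum_{i=1}^n(X_i-\overline X)^2$, and $W_\nu=\overline V+(\overline X-\nu)^2$ for $0\le\nu\le1$. Let $\delta\in(0,1)$. Define $L=0$ if $\overline X=0$, and if $\overline X>0$ $$L=\sup\left\{\nu\in(0,\overline X):\ \max\left[\psi(\overline X,\nu,\vartheta),\ \phi(W_\nu,\vartheta)\,\mathbb I_{\{\vartheta>W_\nu\}}\right]>\frac{\ln\frac3\delta}{n}\ \text{for all }\vartheta\in(0,\nu(1-\nu)]\right\}.$$ Define $U=1$ if $\overline X=1$, and if $\overline X<1$ $$U=\inf\left\{\nu\in(\overline X,1):\ \max\left[\varphi(\overline X,\nu,\vartheta),\ \phi(W_\nu,\vartheta)\,\mathbb I_{\{\vartheta>W_\nu\}}\right]>\frac{\ln\frac3\delta}{n}\ \text{for all }\vartheta\in(0,\nu(1-\nu)]\right\}.$$ Then $\Pr\{L\le\mu\le U\}\ge1-\delta$.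
   Context: $\mathbb I_{\{\vartheta>W_\nu\}}$ equals $1$ if $\vartheta>W_\nu$ and $0$ otherwise. The functions are: $\varphi(z,\nu,\theta)=\left(1-\frac{z\nu}{\nu^2+\theta}\right)\ln\frac{\theta+\nu(\nu-z)}{\theta}+\frac{z\nu}{\nu^2+\theta}\ln\frac z\nu$ for $0<z<\nu<1$, $0<\theta<1$; $\psi(z,\nu,\theta)=\varphi(1-z,1-\nu,\theta)$ for $0<\nu<z<1$, $0<\theta<1$; $\phi(z,\theta)=(1-z)\ln\frac{1-z}{1-\theta}+z\ln\frac z\theta$ for $0<z<1$, $0<\theta<1$. At the boundary values $z=0$ (for $\varphi$ and $\phi$) and $z=1$ (for $\psi$) the functions are extended by continuity, i.e. with the convention $0\ln0=0$. *)

(* Defs.v *)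
From HB Require Import structures.
From mathcomp Require Import all_boot all_order all_algebra.
From mathcomp Require Import all_classical all_reals all_analysis.

Set Implicit Arguments.
Unset Strict Implicit.
Unset Printing Implicit Defensive.

Import Order.TTheory GRing.Theory Num.Theory.
Import numFieldNormedType.Exports.

Local Open Scope classical_set_scope.
Local Open Scope ring_scope.

Definition mutually_independent (R : realType) (d : measure_display)
    (T : measurableType d) (P : probability T R) (I : finType)
    (X : I -> {RV P >-> R}) : Prop :=
  forall (J : {set I}) (B : I -> set R), (forall i, measurable (B i)) ->
    P (\bigcap_(i in [set` J]) (X i @^-1` B i)) =
    (\prod_(i in J) P (X i @^-1` B i))%E.

Definition identically_distributed (R : realType) (d : measure_display)
    (T : measurableType d) (P : probability T R) (I : finType)
    (X : I -> {RV P >-> R}) : Prop :=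
  forall (i j : I) (B : set R), measurable B ->
    distribution P (X i) B = distribution P (X j) B.

Definition iid (R : realType) (d : measure_display)
    (T : measurableType d) (P : probability T R) (I : finType)
    (X : I -> {RV P >-> R}) : Prop :=
  mutually_independent X /\ identically_distributed X.

(* The convention 0 ln 0 = 0 holds below, since 0 * y = 0 for every y. *)
Definition varphi (R : realType) (z nu theta : R) : R :=
  (1 - z * nu / (nu ^+ 2 + theta)) * ln ((theta + nu * (nu - z)) / theta)
  + z * nu / (nu ^+ 2 + theta) * ln (z / nu).

Definition psi (R : realType) (z nu theta : R) : R :=
  varphi (1 - z) (1 - nu) theta.

Definition phi (R : realType) (z theta : R) : R :=
  (1 - z) * ln ((1 - z) / (1 - theta)) + z * ln (z / theta).

Definition sample_mean (R : realType) (n : nat) (x : 'I_n -> R) : R :=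
  n%:R^-1 * \sum_(i < n) x i.

Definition sample_var (R : realType) (n : nat) (x : 'I_n -> R) : R :=
  n%:R^-1 * \sum_(i < n) (x i - sample_mean x) ^+ 2.

Definition W (R : realType) (n : nat) (x : 'I_n -> R) (nu : R) : R :=
  sample_var x + (sample_mean x - nu) ^+ 2.

(* For x with values in [0, 1], n > 0 and 0 < delta < 1, the sets whose sup
   and inf are taken below are nonempty (they contain every nu close enough to
   0, resp. 1) and bounded, so the values of sup and inf on the empty set play
   no role. *)
Definition lower_limit (R : realType) (n : nat) (delta : R)
    (x : 'I_n -> R) : R :=
  if sample_mean x == 0 then 0 else
  sup [set nu : R | 0 < nu < sample_mean x /\
    forall theta : R, 0 < theta <= nu * (1 - nu) ->
      Num.max (psi (sample_mean x) nu theta)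
              (phi (W x nu) theta * (theta > W x nu)%R%:R)
      > ln (3 / delta) / n%:R].

Definition upper_limit (R : realType) (n : nat) (delta : R)
    (x : 'I_n -> R) : R :=
  if sample_mean x == 1 then 1 else
  inf [set nu : R | sample_mean x < nu < 1 /\
    forall theta : R, 0 < theta <= nu * (1 - nu) ->
      Num.max (varphi (sample_mean x) nu theta)
              (phi (W x nu) theta * (theta > W x nu)%R%:R)
      > ln (3 / delta) / n%:R].

(* Main.v *)
(* Write KL(q, p) = phi q p for the divergence of two Bernoulli laws; varphi is
   the same quantity for laws on {0, b}, b = nu + theta / nu.

   Probability.  Independence and the exponential Markov inequality bound by
   exp(- n c) the probability that a sample mean lies below p and is at
   divergence more than c from p, as soon as every summand Y satisfies
   E exp(- t Y) <= 1 - p + p exp(- t).  For Y = (X - mu)^2 this comes from the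
   chord of exp; for Y = X / b and Y = (1 - X) / b from a parabola touching
   exp at 0 and 1.  With exp(- n c) = delta / 3 the three bad events have total
   probability at most delta.

   Determinism.  The set of nu defining U is closed upwards: if theta defeats
   mu, then theta ((nu - z) / (mu - z))^2 defeats every nu in (z, mu).  For phi
   this is contraction of KL under thinning; for varphi, the exponent depends
   only on u = 1 - z / nu once theta / (nu - z)^2 is fixed, and the sign of its
   derivative in u reduces to ln y >= 2 (y - 1) / (y + 1).  Hence U < mu puts mu
   itself in the set, and theta = sigma^2 shows that a bad event occurs; L is
   the mirror image under X -> 1 - X.

   The coverage event has to be shown measurable, because P is unconstrained on
   nonmeasurable sets.  Upward closure makes rational nu sufficient, and
   monotonicity in theta with a connectedness argument makes rational theta
   sufficient. *)
Require Import Defs.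
From HB Require Import structures.
From mathcomp Require Import all_boot all_order all_algebra.
From mathcomp Require Import all_classical all_reals all_analysis.
From mathcomp Require Import measurable_realfun.
From mathcomp Require Import ring lra.

Set Implicit Arguments.
Unset Strict Implicit.
Unset Printing Implicit Defensive.

Import Order.TTheory GRing.Theory Num.Theory.
Import numFieldNormedType.Exports.

Local Open Scope classical_set_scope.
Local Open Scope ring_scope.

(** * Elementary bounds on the logarithm *)

Lemma ln_divE (R : realType) (x y : R) :
  0 < x -> 0 < y -> ln (x / y) = ln x - ln y.
Proof. by move=> x0 y0; rewrite ln_div. Qed.

Lemma ln_ge1BV (R : realType) (y : R) : 0 < y -> 1 - y^-1 <= ln y.
Proof.
move=> y0; rewrite -[leRHS]opprK -lnV ?posrE//.
have V0 : 0 < y^-1 by rewrite invr_gt0.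
have := @le_ln1Dx R (y^-1 - 1); rewrite (_ : 1 + (y^-1 - 1) = y^-1); last by ring.
by move=> /(_ ltac:(lra)) h; lra.
Qed.

Lemma le_is_derive (R : realType) (f df : R -> R) (a b : R) : a <= b ->
  (forall x, a <= x <= b -> is_derive x 1 f (df x)) ->
  (forall x, a <= x <= b -> 0 <= df x) -> f a <= f b.
Proof.
move=> ab hd hp.
have [x xab|x xab|c] := @MVT_segment R f df a b ab.
- by apply: hd; move: xab; rewrite in_itv/= => /andP[/ltW -> /ltW ->].
- apply: derivable_within_continuous xab => y; rewrite in_itv/= => yab.
  by have := hd y yab => -[].
rewrite in_itv/= => cab e; rewrite -subr_ge0 e mulr_ge0 ?hp//; lra.
Qed.

(** With the denominator cleared, (x + 1) ln x - 2 x equals -2 at x = 1, and its derivative ln x -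
    (1 - 1 / x) is nonnegative. *)
Lemma ln_ge_pade (R : realType) (y : R) :
  1 <= y -> 2 * (y - 1) / (y + 1) <= ln y.
Proof.
move=> y1; pose f (x : R) := (x + 1) * ln x - 2 * x.
pose df (x : R) := ln x + (x + 1) * x^-1 - 2.
have : f 1 <= f y.
  apply: (@le_is_derive R f df) => // x /andP[x1 _]; have x0 : 0 < x by lra.
    rewrite /f /df.
    have h := is_derive1_ln x0.
    apply: is_derive_eq.
    by rewrite /GRing.scale/=; field; lra.
  have := @ln_ge1BV R x x0; rewrite /df mulrDl mul1r mulfV ?gt_eqF//; lra.
rewrite /f ln1 => h; rewrite ler_pdivrMr; lra.
Qed.

(** * Bernoulli divergence: sign, thinning, monotonicity in each argument *)

Section kullback_leibler.
Variable R : realType.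
Implicit Types w p r : R.

Lemma phi_id p : 0 < p < 1 -> phi p p = 0.
Proof.
move=> /andP[p0 p1]; rewrite /phi !divff ?ln1; last 2 first.
- by rewrite gt_eqF.
- by rewrite gt_eqF// subr_gt0.
by rewrite !mulr0 addr0.
Qed.

Lemma phi_ge0 w p : 0 <= w < 1 -> 0 < p < 1 -> 0 <= phi w p.
Proof.
move=> /andP[w0 w1] /andP[p0 p1]; rewrite /phi.
have h1 : (1 - w) * (1 - ((1 - w) / (1 - p))^-1) <= (1 - w) * ln ((1 - w) / (1 - p)).
  by apply: ler_wpM2l; [lra | apply: ln_ge1BV; rewrite divr_gt0//; lra].
have h2 : w - p <= w * ln (w / p).
  move: w0; rewrite le_eqVlt => /predU1P[<-|w0]; first by rewrite !mul0r; lra.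
  have : w * (1 - (w / p)^-1) <= w * ln (w / p).
    by apply: ler_wpM2l; [lra | apply: ln_ge1BV; rewrite divr_gt0//; lra].
  by rewrite invf_div mulrBr mulr1 mulrCA divff ?mulr1// gt_eqF.
have e : (1 - w) * (1 - ((1 - w) / (1 - p))^-1) = p - w.
  by rewrite invf_div; field; lra.
lra.
Qed.

(** The log-sum inequality for the splitting 1 - r w = r (1 - w) + (1 - r), and likewise for p,
    gives the sharper bound r * phi w p; the success terms agree on both sides. *)
Lemma phi_thin w p r : 0 <= w < 1 -> 0 < p < 1 -> 0 < r <= 1 ->
  phi (r * w) (r * p) <= phi w p.
Proof.
move=> wI pI /andP[r0 r1].
suff h : phi (r * w) (r * p) <= r * phi w p.
  by apply: (le_trans h); rewrite ler_piMl// phi_ge0.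
move: wI pI => /andP[w0 w1] /andP[p0 p1]; rewrite /phi.
have -> : r * w / (r * p) = w / p by field; rewrite !gt_eqF.
rewrite mulrDr [r * (w * _)]mulrA lerD2r.
set A := 1 - r * w; set B := 1 - r * p.
have A0 : 0 < A by rewrite /A; nra.
have B0 : 0 < B by rewrite /B; nra.
have a0 : 0 < 1 - w by lra.
have b0 : 0 < 1 - p by lra.
have h1 : r * (1 - w) * (1 - ((1 - w) * B / ((1 - p) * A))^-1) <=
          r * (1 - w) * ln ((1 - w) * B / ((1 - p) * A)).
  by apply: ler_wpM2l; [nra | apply: ln_ge1BV; rewrite divr_gt0// mulr_gt0].
have h2 : (1 - r) * (1 - (B / A)^-1) <= (1 - r) * ln (B / A).
  by apply: ler_wpM2l; [lra | apply: ln_ge1BV; rewrite divr_gt0].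
(* The lower bounds from ln y >= 1 - 1 / y cancel exactly. *)
have e : r * (1 - w) * (1 - ((1 - w) * B / ((1 - p) * A))^-1)
       + (1 - r) * (1 - (B / A)^-1) = 0.
  have -> : ((1 - w) * B / ((1 - p) * A))^-1 = (1 - p) * A / ((1 - w) * B).
    by rewrite invf_div.
  rewrite invf_div.
  transitivity (r * (1 - w) + (1 - r) - A * (r * (1 - p) + (1 - r)) / B).
    by field; rewrite !gt_eqF.
  have -> : r * (1 - p) + (1 - r) = B by rewrite /B; ring.
  by rewrite mulfK ?gt_eqF// /A; ring.
move: h1 h2 e; rewrite !ln_divE ?mulr_gt0// !lnM ?posrE// => h1 h2 e.
have : A = r * (1 - w) + (1 - r) by rewrite /A; ring.
move=> eA; rewrite {1}eA; nra.
Qed.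

Lemma phi_antitone w w' p : 0 <= w -> w <= w' -> w' <= p -> 0 < p < 1 ->
  phi w' p <= phi w p.
Proof.
move=> w0 ww' w'p pI; move: (pI) => /andP[p0 p1].
have [<-//|neww'] := eqVneq w w'.
have w'0 : 0 < w' by rewrite (le_lt_trans w0)// lt_neqAle neww'.
have h : 0 <= phi w w' by apply: phi_ge0; lra.
have hl : 0 <= (w' - w) * ln ((1 - w') * p / (w' * (1 - p))).
  apply: mulr_ge0; first lra.
  by apply: ln_ge0; rewrite ler_pdivlMr ?mulr_gt0//; nra.
(* Three-point identity of the divergence through w'; the last logarithm is the difference of the
   logits of p and w', nonnegative because w' <= p. *)
have e : phi w p = phi w' p + phi w w' + (w' - w) * ln ((1 - w') * p / (w' * (1 - p))).
  have u0 : 0 < 1 - w' by lra.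
  have v0 : 0 < 1 - w by lra.
  have q0 : 0 < 1 - p by lra.
  rewrite /phi.
  rewrite (@ln_divE R ((1 - w') * p)) ?mulr_gt0//.
  rewrite (@ln_divE R (1 - w)) // (@ln_divE R (1 - w'))// (@ln_divE R w' p)//.
  rewrite (@ln_divE R (1 - w)) // (@lnM R (1 - w')) ?posrE// (@lnM R w') ?posrE//.
  move: w0; rewrite le_eqVlt => /predU1P[<-|wp]; first by rewrite !mul0r; ring.
  by rewrite (@ln_divE R w)// (@ln_divE R w)//; ring.
lra.
Qed.

Lemma phi_mono w p p' : 0 <= w -> w <= p -> p <= p' -> 0 < p -> p' < 1 ->
  phi w p <= phi w p'.
Proof.
move=> w0 wp pp' p0 p'1; have p1 : p < 1 by lra.
have p'0 : 0 < p' by lra.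
have q0 : 0 < 1 - p by lra.
have q'0 : 0 < 1 - p' by lra.
have h1 : (1 - w) * (1 - ((1 - p) / (1 - p'))^-1) <= (1 - w) * ln ((1 - p) / (1 - p')).
  by apply: ler_wpM2l; [lra | apply: ln_ge1BV; rewrite divr_gt0].
have h2 : w * (1 - (p / p')^-1) <= w * ln (p / p').
  by apply: ler_wpM2l; [lra | apply: ln_ge1BV; rewrite divr_gt0].
(* [h1] and [h2] bound the two halves of phi w p' - phi w p from below; their sum has the sign of p
   - w. *)
have e : (1 - w) * (1 - ((1 - p) / (1 - p'))^-1) + w * (1 - (p / p')^-1) =
  (p' - p) * (p - w) / (p * (1 - p)).
  by rewrite !invf_div; field; rewrite !gt_eqF.
have e0 : 0 <= (p' - p) * (p - w) / (p * (1 - p)).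
  by rewrite divr_ge0// mulr_ge0; lra.
have w1 : w < 1 by lra.
have v0 : 0 < 1 - w by lra.
rewrite /phi !(@ln_divE R (1 - w))//; rewrite !(@ln_divE R (1 - p)) ?ln_divE// in h1 h2.
move: w0; rewrite le_eqVlt => /predU1P[w0|w0].
  by rewrite -w0 !mul0r in h1 h2 e e0 *; lra.
rewrite !ln_divE//; lra.
Qed.

End kullback_leibler.

(** * The exponent [varphi] as a two-point divergence *)

Lemma is_derive_ln (R : realType) (f : R -> R) (x df : R) :
  is_derive x 1 f df -> 0 < f x -> is_derive x 1 (fun y => ln (f y)) (df / f x).
Proof.
move=> hf fx0; rewrite mulrC.
exact: (@is_derive1_comp R (@ln R) f x _ _ (is_derive1_ln fx0) hf).
Qed.

Section two_point_exponent.
Variable R : realType.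
Implicit Types z nu theta k u : R.

(* varphi is the divergence of two-point laws on {0, b} with means z and nu,
   where b = nu + theta / nu makes theta the variance of the second one. *)
Lemma varphiE z nu theta : 0 <= z -> z < nu -> 0 < theta ->
  varphi z nu theta = phi (z / (nu + theta / nu)) (nu / (nu + theta / nu)).
Proof.
move=> z0 znu t0; have nu0 : 0 < nu by lra.
have d0 : 0 < nu ^+ 2 + theta by rewrite addr_gt0// exprn_gt0.
rewrite /varphi /phi; congr (_ * ln _ + _ * ln _).
- by field; rewrite !gt_eqF.
- have -> : 1 - nu / (nu + theta / nu) = theta / (nu ^+ 2 + theta).
    by field; rewrite !gt_eqF.
  by field; rewrite !gt_eqF.
- by field; rewrite !gt_eqF.
- by field; rewrite !gt_eqF.
Qed.

(** A larger theta enlarges the atom b, which multiplies z / b and nu / b by the same factor b / b'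
    <= 1: this is a thinning. *)
Lemma varphi_antitone z nu theta theta' :
  0 <= z -> z < nu -> 0 < theta -> theta <= theta' ->
  varphi z nu theta' <= varphi z nu theta.
Proof.
move=> z0 znu t0 tt'; have nu0 : 0 < nu by lra.
have t'0 : 0 < theta' by lra.
rewrite !varphiE//.
set b := nu + theta / nu; set b' := nu + theta' / nu.
have nub : nu < b by rewrite ltrDl divr_gt0.
have b0 : 0 < b by lra.
have bb' : b <= b' by rewrite lerD2l ler_pM2r ?invr_gt0.
have b'0 : 0 < b' by lra.
have -> : z / b' = (b / b') * (z / b) by field; rewrite !gt_eqF.
have -> : nu / b' = (b / b') * (nu / b) by field; rewrite !gt_eqF.
apply: phi_thin.
- by rewrite divr_ge0//= ?(ltW b0)// ltr_pdivrMr//; lra.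
- by rewrite divr_gt0//= ltr_pdivrMr//; lra.
- by rewrite divr_gt0//= ler_pdivrMr//; lra.
Qed.

(** On the curve theta = k (nu - z)^2, [varphi] equals [num k u / den k u] with u = 1 - z / nu, so
    that z and nu enter only through u. *)
Let num k u :=
  u * (1 + k * u) * (ln (1 + k * u) - ln (k * u)) + (1 - u) * ln (1 - u).

Let den k u := 1 + k * u ^+ 2.

Let is_derive_num k u : 0 < k -> 0 < u < 1 ->
  is_derive u 1 (num k)
    ((1 + 2 * k * u) * (ln (1 + k * u) - ln (k * u)) - 2 - ln (1 - u)).
Proof.
move=> k0 /andP[u0 u1].
have ku0 : 0 < k * u by rewrite mulr_gt0.
have h1 : is_derive u 1 (fun x : R => 1 + k * x) k.
  by apply: is_derive_eq; rewrite /GRing.scale/=; ring.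
have h2 : is_derive u 1 (fun x : R => k * x) k.
  by apply: is_derive_eq; rewrite /GRing.scale/=; ring.
have h3 : is_derive u 1 (fun x : R => 1 - x) (-1).
  by apply: is_derive_eq; rewrite /GRing.scale/=; ring.
have l1 := is_derive_ln h1 (ltac:(lra) : 0 < 1 + k * u).
have l2 := is_derive_ln h2 ku0.
have l3 := is_derive_ln h3 (ltac:(lra) : 0 < 1 - u).
rewrite /num; apply: is_derive_eq.
by rewrite /GRing.scale/=; field; rewrite !gt_eqF//; lra.
Qed.

(* The derivative has the sign of ln y - 2 (y - 1) / (y + 1) with
   y = (1 + k u) / (k u (1 - u)). *)
Let num_div_den_mono k u v : 0 < k -> 0 < u -> u <= v -> v < 1 ->
  num k u / den k u <= num k v / den k v.
Proof.
move=> k0 u0 uv v1.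
have den0 x : 0 < den k x by rewrite /den; nra.
apply: (@le_is_derive R (fun x => num k x / den k x) (fun x =>
  (((1 + 2 * k * x) * (ln (1 + k * x) - ln (k * x)) - 2 - ln (1 - x)) * den k x
   - num k x * (2 * k * x)) / den k x ^+ 2)) => // x /andP[ux xv].
  have xI : 0 < x < 1 by lra.
  have hn := is_derive_num k0 xI.
  have hd : is_derive x 1 (den k) (2 * k * x).
    by rewrite /den; apply: is_derive_eq; rewrite /GRing.scale/=; ring.
  have hV := @is_deriveV R (den k) x _ _ (lt0r_neq0 (den0 x)) hd.
  apply: is_derive_eq.
  by rewrite /GRing.scale/=; field; rewrite gt_eqF.
have x0 : 0 < x by lra.
have x1 : x < 1 by lra.
have kx0 : 0 < k * x by rewrite mulr_gt0.
rewrite divr_ge0 ?sqr_ge0//.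
pose y := (1 + k * x) / (k * x * (1 - x)).
have d0 : 0 < k * x * (1 - x) by rewrite mulr_gt0//; lra.
have y1 : 1 <= y by rewrite ler_pdivlMr// mul1r; nra.
have C0 : 0 < 1 + 2 * k * x - k * x ^+ 2 by nra.
have e : 2 * (y - 1) / (y + 1) = 2 * den k x / (1 + 2 * k * x - k * x ^+ 2).
  have -> : y - 1 = den k x / (k * x * (1 - x)).
    by rewrite /y /den; field; rewrite !gt_eqF//; lra.
  have -> : y + 1 = (1 + 2 * k * x - k * x ^+ 2) / (k * x * (1 - x)).
    by rewrite /y; field; rewrite !gt_eqF//; lra.
  move: (1 + _ - _) (k * x * _) C0 d0 => C e C0 e0.
  by field; rewrite !gt_eqF.
have := ln_ge_pade y1; rewrite e ler_pdivrMr//.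
rewrite /y ln_divE//; last lra.
rewrite (@lnM _ (k * x)) ?posrE//; last lra.
rewrite /num /den => h.
rewrite (_ : _ - _ = (ln (1 + k * x) - (ln (k * x) + ln (1 - x))) *
  (1 + 2 * k * x - k * x ^+ 2) - 2 * (1 + k * x ^+ 2)); last by ring.
by rewrite subr_ge0.
Qed.

Lemma varphi_diag_mono z nu mu k : 0 <= z -> z < nu -> nu <= mu -> 0 < k ->
  varphi z nu (k * (nu - z) ^+ 2) <= varphi z mu (k * (mu - z) ^+ 2).
Proof.
rewrite le_eqVlt => /predU1P[<- nu0 numu k0|z0 znu numu k0].
  (* At z = 0 the variable u is 1, outside the range of [num_div_den_mono]; there [varphi] is
     constant along the curve. *)
  have e x : 0 < x -> varphi 0 x (k * (x - 0) ^+ 2) = ln ((k + 1) / k).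
    move=> x0; rewrite /varphi !mul0r subr0 mul1r addr0 subr0; congr ln.
    by field; rewrite !gt_eqF.
  by rewrite !e//; lra.
have e x : z < x -> varphi z x (k * (x - z) ^+ 2) =
    num k (1 - z / x) / den k (1 - z / x).
  move=> zx; have x0 : 0 < x by lra.
  have h0 : 0 < x - z by lra.
  have kh : 0 < k * (x - z) by rewrite mulr_gt0.
  have D0 : 0 < x ^+ 2 + k * (x - z) ^+ 2 by rewrite addr_gt0 ?mulr_gt0 ?exprn_gt0.
  rewrite /varphi /num /den.
  have -> : 1 - (1 - z / x) = z / x by ring.
  have u0 : 0 < 1 - z / x by rewrite subr_gt0 ltr_pdivrMr//; lra.
  rewrite -ln_divE; [|by rewrite addr_gt0 ?mulr_gt0|by rewrite mulr_gt0].
  have -> : (1 + k * (1 - z / x)) / (k * (1 - z / x)) =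
    (k * (x - z) ^+ 2 + x * (x - z)) / (k * (x - z) ^+ 2).
    by field; rewrite !gt_eqF.
  by field; rewrite !gt_eqF.
rewrite !e//; last lra.
have mu0 : 0 < mu by lra.
have nu0 : 0 < nu by lra.
apply: num_div_den_mono => //.
- by rewrite subr_gt0 ltr_pdivrMr//; lra.
- by rewrite lerD2l lerN2 ler_pM2l// lef_pV2.
- by rewrite ltrBlDr ltrDl divr_gt0.
Qed.

End two_point_exponent.

(** * The set that defines the upper limit *)

Section confidence_set.
Variable R : realType.
Implicit Types c z v w nu mu theta r : R.

Definition left_phi w theta : R := phi w theta * (w < theta)%R%:R.

Lemma left_phi_ge0 w theta : 0 <= w -> 0 < theta < 1 -> 0 <= left_phi w theta.
Proof.
move=> w0 tI; rewrite /left_phi; case: ltP => wt; last by rewrite mulr0.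
by rewrite mulr1 phi_ge0//; lra.
Qed.

Lemma left_phi_mono w theta theta' : 0 <= w -> 0 < theta -> theta <= theta' ->
  theta' < 1 -> left_phi w theta <= left_phi w theta'.
Proof.
move=> w0 t0 tt' t'1; have h : 0 <= left_phi w theta' by apply: left_phi_ge0; lra.
rewrite {1}/left_phi; case: ltP => wt; last by rewrite mulr0.
rewrite mulr1 /left_phi (lt_le_trans wt tt') mulr1; apply: phi_mono => //; lra.
Qed.

(** An inequality r w <= w' is what the application offers: with r = s^2 the squared bias scales
    exactly, while the variance v does not shrink. *)
Lemma left_phi_thin w w' theta r : 0 <= w -> 0 < theta < 1 -> 0 < r <= 1 ->
  r * w <= w' -> left_phi w' (r * theta) <= left_phi w theta.
Proof.
move=> w0 tI rI rww'.
have h : 0 <= left_phi w theta by exact: left_phi_ge0.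
rewrite {1}/left_phi; case: ltP => wt; last by rewrite mulr0.
move: (rI) (tI) => /andP[r0 r1] /andP[t0 t1].
have wt' : w < theta by rewrite -(ltr_pM2l r0); lra.
rewrite mulr1 /left_phi wt' mulr1.
apply: (@le_trans _ _ (phi (r * w) (r * theta))).
  by apply: phi_antitone => //; nra.
by apply: phi_thin => //; lra.
Qed.

(** The sample enters only through its mean z and variance v, so that the same set at mean 1 - z
    describes the lower limit. *)
Definition upper_set c z v : set R := [set nu | z < nu < 1 /\
  forall theta, 0 < theta <= nu * (1 - nu) ->
    Num.max (varphi z nu theta) (left_phi (v + (z - nu) ^+ 2) theta) > c].

Lemma upper_set_upclosed c z v nu mu : 0 <= z -> 0 <= v ->
  nu \in upper_set c z v -> nu <= mu -> mu < 1 -> mu \in upper_set c z v.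
Proof.
move=> z0 v0; rewrite !inE /upper_set/= => -[/andP[znu nu1] H] numu mu1.
split=> [|theta /andP[t0 tmu]]; first lra.
have hmu : 0 < mu - z by lra.
pose s := (nu - z) / (mu - z).
have s0 : 0 < s by rewrite divr_gt0//; lra.
have s1 : s <= 1 by rewrite ler_pdivrMr//; lra.
have esmu : s * (mu - z) = nu - z by rewrite /s mulfVK// gt_eqF.
have enu : nu = (1 - s) * z + s * mu by lra.
have r0 : 0 < s ^+ 2 by rewrite exprn_gt0.
have r1 : s ^+ 2 <= 1 by rewrite exprn_ile1// ltW.
have t1 : theta < 1 by nra.
have tI : 0 < s ^+ 2 * theta <= nu * (1 - nu).
  rewrite mulr_gt0//=.
  (* Since nu is a convex combination of z and mu, concavity of x (1 - x), with its explicit excess,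
     keeps s^2 theta in the range allowed for nu. *)
  have -> : nu * (1 - nu) = (1 - s) * (z * (1 - z)) + s * (mu * (1 - mu))
    + s * (1 - s) * (mu - z) ^+ 2 by rewrite enu; ring.
  have h1 : 0 <= (1 - s) * (z * (1 - z)) by rewrite !mulr_ge0//; lra.
  have h2 : 0 <= s * (1 - s) * (mu - z) ^+ 2.
    by rewrite mulr_ge0 ?sqr_ge0// mulr_ge0//; lra.
  have h3 : s ^+ 2 * theta <= s * (mu * (1 - mu)).
    rewrite expr2 -mulrA ler_pM2l// (le_trans _ tmu)// ler_piMl//; lra.
  lra.
apply: lt_le_trans (H _ tI) _.
have h1 : varphi z nu (s ^+ 2 * theta) <= varphi z mu theta.
  (* This k places (mu, theta) and (nu, s^2 theta) on one curve. *)
  have := @varphi_diag_mono R z nu mu (theta / (mu - z) ^+ 2) z0 znu numu.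
  rewrite divr_gt0 ?exprn_gt0// => /(_ isT).
  rewrite mulfVK ?gt_eqF ?exprn_gt0//.
  by rewrite (_ : _ * (nu - z) ^+ 2 = s ^+ 2 * theta)// /s; field; rewrite gt_eqF.
have h2 : left_phi (v + (z - nu) ^+ 2) (s ^+ 2 * theta) <=
          left_phi (v + (z - mu) ^+ 2) theta.
  apply: left_phi_thin; [|lra..|].
    by rewrite addr_ge0// sqr_ge0.
  rewrite mulrDr -exprMn lerD//; first by rewrite ler_piMl.
  by rewrite (_ : s * (z - mu) = z - nu)//; lra.
by rewrite ge_max !le_max h1 h2 orbT.
Qed.

Lemma mul_ln_div_geN1 z nu : 0 <= z -> 0 < nu <= 1 -> -1 <= z * ln (z / nu).
Proof.
move=> z0 /andP[nu0 nu1].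
move: z0; rewrite le_eqVlt => /predU1P[<-|z0]; first by rewrite !mul0r; lra.
have : z * (1 - (z / nu)^-1) <= z * ln (z / nu).
  by rewrite ler_pM2l// ln_ge1BV// divr_gt0.
by rewrite invf_div mulrBr mulr1 mulrCA divff ?mulr1 ?gt_eqF//; lra.
Qed.

Lemma upper_set_neq0 c z v : 0 < c -> 0 <= z < 1 -> upper_set c z v !=set0.
Proof.
move=> c0 /andP[z0 z1].
(* Chosen so that the term (1 - z) ln ((1 - z) / (1 - nu)) equals c + 2; the other term of the
   divergence is at least -1. *)
pose A := (c + 2) / (1 - z); pose nu := 1 - (1 - z) * expR (- A).
have A0 : 0 < A by rewrite divr_gt0; lra.
have e0 := expR_gt0 (- A).
have e1 : expR (- A) < 1 by rewrite expR_lt1; lra.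
have znu : z < nu < 1 by rewrite /nu; nra.
exists nu; split=> // theta /andP[t0 tnu].
rewrite lt_max; apply/orP; left.
move: (znu) => /andP[znu1 nu1].
have nu0 : 0 < nu by lra.
have M0 : 0 < nu * (1 - nu) by rewrite mulr_gt0//; lra.
apply: (@lt_le_trans _ _ (varphi z nu (nu * (1 - nu)))); last first.
  exact: varphi_antitone.
(* At the largest theta the atom b is 1 and [varphi] is [phi z nu]. *)
rewrite varphiE// (_ : nu + _ = 1); last by field; rewrite gt_eqF.
rewrite !divr1 /phi.
have -> : ln ((1 - z) / (1 - nu)) = A.
  have -> : (1 - z) / (1 - nu) = expR A.
    by rewrite /nu expRN; field; rewrite !gt_eqF ?expR_gt0//; lra.
  by rewrite expRK.
have -> : (1 - z) * A = c + 2 by rewrite /A mulrCA divff ?mulr1// gt_eqF//; lra.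
have := @mul_ln_div_geN1 z nu z0 ltac:(lra); lra.
Qed.

(** Blow-up of [varphi] as theta tends to 0; it keeps the infimum taken in [upper_set_ratP] away
    from 0. *)
Lemma varphi_gt_near0 c z nu : 0 < c -> 0 <= z -> z < nu -> nu < 1 ->
  exists2 theta, 0 < theta & c < varphi z nu theta.
Proof.
move=> c0 z0 znu nu1; have nu0 : 0 < nu by lra.
have h0 : 0 < nu - z by lra.
(* The first coefficient of [varphi] is at least (nu - z) / nu and its logarithm at least A, with
   product c + 2; the second term is at least -1. *)
pose A := (c + 2) * nu / (nu - z).
have A0 : 0 < A by rewrite divr_gt0// mulr_gt0//; lra.
pose theta := nu * (nu - z) * expR (- A).
have t0 : 0 < theta by rewrite !mulr_gt0// expR_gt0.
exists theta => //.
have b0 : 0 < nu + theta / nu by rewrite addr_gt0// divr_gt0.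
have d0 : 0 < nu ^+ 2 + theta by rewrite addr_gt0// exprn_gt0.
have h1 : (nu - z) / nu <= 1 - z * nu / (nu ^+ 2 + theta).
  rewrite mulrBl divff ?gt_eqF// lerD2l lerN2 ler_pdivrMr// mulrAC ler_pdivlMr//.
  by nra.
have h2 : A <= ln ((theta + nu * (nu - z)) / theta).
  have nuz0 : 0 < nu * (nu - z) by exact: mulr_gt0.
  rewrite -[leLHS]expRK ler_ln ?posrE ?expR_gt0 ?divr_gt0 ?addr_gt0//.
  rewrite ler_pdivlMr// {1}/theta expRN mulrCA mulfV ?gt_eqF ?expR_gt0// mulr1.
  by rewrite lerDr ltW.
have h3 : -1 <= z * nu / (nu ^+ 2 + theta) * ln (z / nu).
  have hz : 0 <= z / (nu + theta / nu) by apply: divr_ge0 => //; exact: ltW.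
  have hnu : 0 < nu / (nu + theta / nu) <= 1.
    rewrite divr_gt0//= ler_pdivrMr// mul1r lerDl; apply: divr_ge0; exact: ltW.
  have := mul_ln_div_geN1 hz hnu.
  have -> : z / (nu + theta / nu) = z * nu / (nu ^+ 2 + theta).
    by field; rewrite !gt_eqF.
  have -> : z * nu / (nu ^+ 2 + theta) / (nu / (nu + theta / nu)) = z / nu.
    by field; rewrite !gt_eqF.
  by [].
have h4 : c + 2 <= (1 - z * nu / (nu ^+ 2 + theta)) * ln ((theta + nu * (nu - z)) / theta).
  have -> : c + 2 = (nu - z) / nu * A by rewrite /A; field; rewrite !gt_eqF.
  apply: ler_pM h1 h2; last exact: ltW.
  by apply: divr_ge0; exact: ltW.
by rewrite /varphi; lra.
Qed.

End confidence_set.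

(** * Continuity in theta and reduction to rational theta *)

Section rational_reduction.
Variable R : realType.
Implicit Types c z v w p x nu theta : R.

Lemma continuous_ln_comp (f : R -> R) x : {for x, continuous f} -> 0 < f x ->
  {for x, continuous (fun y => ln (f y))}.
Proof.
move=> cf fx; apply: (@continuous_comp _ _ _ f (@ln R)) => //.
exact: continuous_ln.
Qed.

Lemma continuous_gt_ball (f : R -> R) x c : {for x, continuous f} -> c < f x ->
  exists2 e, 0 < e & forall y, `|x - y| < e -> c < f y.
Proof.
move=> cf cfx.
have : \forall y \near x, c < f y by exact: (cvgr_gt (f x) cf).
by case/nbhs_ballP => e /= e0 He; exists e => // y; exact: He.
Qed.

Lemma continuous_varphi z nu theta : 0 <= z -> z < nu -> 0 < theta ->
  {for theta, continuous (varphi z nu)}.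
Proof.
move=> z0 znu t0; have nu0 : 0 < nu by lra.
have d0 : 0 < nu ^+ 2 + theta by rewrite addr_gt0// exprn_gt0.
have cq : {for theta, continuous (fun x => z * nu / (nu ^+ 2 + x))}.
  apply: cvgM; first exact: cvg_cst.
  by apply: cvgV; [rewrite gt_eqF|apply: cvgD; [exact: cvg_cst|exact: cvg_id]].
apply: cvgD; apply: cvgM => //; last exact: cvg_cst.
  by apply: cvgB => //; exact: cvg_cst.
apply: (@continuous_ln_comp (fun x => (x + nu * (nu - z)) / x)).
  apply: cvgM; first by apply: cvgD; [exact: cvg_id|exact: cvg_cst].
  by apply: cvgV; [rewrite gt_eqF|exact: cvg_id].
by rewrite divr_gt0// addr_gt0// mulr_gt0// subr_gt0.
Qed.

Lemma continuous_phi_right w p : 0 <= w < 1 -> 0 < p < 1 ->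
  {for p, continuous (phi w)}.
Proof.
move=> /andP[w0 w1] /andP[p0 p1]; apply: cvgD; apply: cvgM; try exact: cvg_cst.
  apply: (@continuous_ln_comp (fun x => (1 - w) / (1 - x))); last by rewrite divr_gt0//; lra.
  apply: cvgM; first exact: cvg_cst.
  apply: cvgV; first by rewrite gt_eqF//; lra.
  by apply: cvgB; [exact: cvg_cst|exact: cvg_id].
move: w0; rewrite le_eqVlt => /predU1P[<-|w0].
  under eq_fun do rewrite mul0r.
  by rewrite mul0r; exact: cvg_cst.
apply: (@continuous_ln_comp (fun x => w / x)); last by rewrite divr_gt0.
apply: cvgM; first exact: cvg_cst.
by apply: cvgV; [rewrite gt_eqF|exact: cvg_id].
Qed.

Lemma continuous_phi_left w p : 0 < w < 1 -> 0 < p < 1 ->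
  {for w, continuous (fun x => phi x p)}.
Proof.
move=> /andP[w0 w1] /andP[p0 p1].
have c1 : {for w, continuous (fun x : R => 1 - x)}.
  by apply: cvgB; [exact: cvg_cst|exact: cvg_id].
apply: cvgD; apply: cvgM => //; try exact: cvg_id.
  apply: (@continuous_ln_comp (fun x => (1 - x) / (1 - p))); last by rewrite divr_gt0//; lra.
  by apply: cvgM => //; exact: cvg_cst.
apply: (@continuous_ln_comp (fun x => x / p)); last by rewrite divr_gt0.
by apply: cvgM; [exact: cvg_id|exact: cvg_cst].
Qed.

(* varphi decreases and left_phi increases with theta, so the two open
   conditions cover the interval iff the first holds at its right end or they
   overlap. *)
Lemma upper_set_ratP c z v nu : 0 < c -> 0 <= z -> 0 <= v -> z < nu < 1 ->
  upper_set c z v nu <->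
  c < varphi z nu (nu * (1 - nu)) \/
  exists q : rat, [/\ 0 < (ratr q : R) <= nu * (1 - nu), c < varphi z nu (ratr q) &
    c < left_phi (v + (z - nu) ^+ 2) (ratr q)].
Proof.
move=> c0 z0 v0 nuI; move: (nuI) => /andP[znu nu1]; have nu0 : 0 < nu by lra.
set M := nu * (1 - nu); have M0 : 0 < M by rewrite mulr_gt0//; lra.
have M1 : M < 1 by rewrite /M; nra.
set w := v + (z - nu) ^+ 2; have w0 : 0 <= w by rewrite addr_ge0// sqr_ge0.
split=> [[_ H]|H]; last first.
  split=> // theta /andP[t0 tM]; rewrite lt_max.
  case: H => [cM|[q [/andP[q0 qM] c1 c2]]].
    by apply/orP; left; apply: (lt_le_trans cM); exact: varphi_antitone.
  have [tq|qt] := leP theta (ratr q).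
    by apply/orP; left; apply: (lt_le_trans c1); exact: varphi_antitone.
  apply/orP; right; apply: (lt_le_trans c2).
  by apply: left_phi_mono => //; [exact: ltW|exact: le_lt_trans M1].
have [cM|Mc] := ltP c (varphi z nu M); [by left|right].
(* The infimum [t0] of the theta at which [varphi] fails to exceed c is itself such a point, by
   continuity. There [left_phi] must exceed c, and it still does slightly to the left, where
   [varphi] exceeds c as well. *)
pose A := [set theta | 0 < theta <= M /\ varphi z nu theta <= c].
have AM : A M by split=> //; rewrite M0 lexx.
have [ts ts0 cts] := varphi_gt_near0 c0 z0 znu nu1.
have lbA : lbound A ts.
  move=> t [/andP[t0 _] tc]; rewrite leNgt; apply/negP => tts.
  have : varphi z nu ts <= varphi z nu t by apply: varphi_antitone => //; exact: ltW.
  lra.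
have hA : has_inf A by split; [exists M|exists ts].
pose t0 := inf A.
have tst0 : ts <= t0 by apply: lb_le_inf => //; exists M.
have t0M : t0 <= M by apply: ge_inf => //; exists ts.
have t00 : 0 < t0 by lra.
have ft0 : varphi z nu t0 <= c.
  rewrite leNgt; apply/negP => ct0.
  have [e e0 He] := continuous_gt_ball (continuous_varphi z0 znu t00) ct0.
  have [t [tI tc] te] := inf_adherent e0 hA.
  have tt : t0 <= t by apply: ge_inf; [exists ts|].
  have := He t; rewrite distrC ger0_norm ?subr_ge0//.
  move: te; rewrite -/t0 => te /(_ ltac:(lra)); lra.
have /H : 0 < t0 <= M by rewrite t00.
rewrite lt_max ltNge ft0/= => gt0.
have wt0 : w < t0.
  rewrite ltNge; apply/negP => t0w.
  by move: gt0; rewrite /left_phi (ltNge w) t0w mulr0; lra.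
have : c < phi w t0 by move: gt0; rewrite /left_phi wt0 mulr1.
move=> /(continuous_gt_ball (@continuous_phi_right w t0 ltac:(lra) ltac:(lra))).
move=> [e e0 He].
(* A rational between [l] and [t0] is positive, satisfies the indicator, and lies within the
   continuity radius. *)
pose l := Num.max (Num.max 0 w) (t0 - e).
have lt0 : l < t0 by rewrite !gt_max t00 wt0/=; lra.
have [q] := rat_in_itvoo lt0; rewrite in_itv/= => /andP[lq qt0].
move: lq; rewrite !gt_max => /andP[/andP[q0 wq] eq].
exists q; split.
- by rewrite q0/=; lra.
- rewrite ltNge; apply/negP => qc.
  have : A (ratr q) by split=> //; rewrite q0/=; lra.
  by move=> /(ge_inf (ex_intro _ ts lbA)); rewrite -/t0; lra.
- rewrite /left_phi wq mulr1; apply: He; rewrite ger0_norm; lra.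
Qed.

End rational_reduction.

(** * Expectations of products of independent variables *)

Section independent_products.
Context (R : realType) (d : measure_display) (T : measurableType d)
  (P : probability T R).

Lemma integral_probability_cst (r : R) : (\int[P]_w r%:E = r%:E)%E.
Proof. by rewrite integral_cst// [X in (_ * X)%E](probability_setT P) mule1. Qed.

Lemma integral_sum_indic (J : finType) (C : J -> R) (E : J -> set T) :
  (forall j, 0 <= C j) -> (forall j, measurable (E j)) ->
  (\int[P]_w (\sum_j C j * \1_(E j) w)%:E =
   (\sum_j C j * fine (P (E j)))%:E)%E.
Proof.
move=> C0 mE.
transitivity (\int[P]_w (\sum_(j <- index_enum J) ((C j)%:E * (\1_(E j) w)%:E)))%E.
  by apply: eq_integral => w _; rewrite -sumEFin.
rewrite ge0_integral_sum//=; last 2 first.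
- move=> j; apply/measurable_EFinP.
  by apply: measurable_funM => //; exact: measurable_indic.
- by move=> j w _; rewrite -EFinM lee_fin mulr_ge0.
rewrite -sumEFin; apply: eq_bigr => j _.
rewrite ge0_integralZl_EFin//.
- by rewrite integral_indic// setIT EFinM fineK// fin_num_measure.
- by apply/measurable_EFinP; exact: measurable_indic.
Qed.

Section iid_products.
Variables (n : nat) (X : 'I_n -> {RV P >-> R}).
Hypothesis Xind : mutually_independent X.

(** Distributing the product over the sums leaves one box indicator per choice function f, and
    independence factors the probability of each box. *)
Lemma integral_prod_step (K : finType) (C : K -> R) (B : K -> set R) :
  (forall k, 0 <= C k) -> (forall k, measurable (B k)) ->
  (\int[P]_w (\prod_i \sum_k C k * \1_(B k) (X i w))%:E =
   \prod_i \int[P]_w (\sum_k C k * \1_(B k) (X i w))%:E)%E.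
Proof.
move=> C0 mB.
have mXB i k : measurable (X i @^-1` B k).
  by rewrite -[X in measurable X]setTI; exact: measurable_funP.
pose E (f : {ffun 'I_n -> K}) := \bigcap_(i in [set` [set: 'I_n]%SET]) (X i @^-1` B (f i)).
have mE f : measurable (E f).
  by apply: fin_bigcap_measurable.
transitivity (\int[P]_w
    (\sum_(f : {ffun 'I_n -> K}) (\prod_i C (f i)) * \1_(E f) w)%:E)%E.
  apply: eq_integral => w _; congr (_%:E).
  rewrite bigA_distr_bigA; apply: eq_bigr => f _.
  rewrite big_split/=; congr (_ * _).
  rewrite !indicE; have [wE|wE] := boolP (w \in E f).
    rewrite big1// => i _; rewrite indicE mem_set//.
    by move: wE; rewrite inE => /(_ i); apply; rewrite /= inE.
  apply/eqP; rewrite prodf_seq_eq0; apply/hasP.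
  have /existsNP[i /not_implyP[_ wB]] : ~ E f w by move=> h; move: wE; rewrite mem_set.
  exists i; first by rewrite mem_index_enum.
  by rewrite /= indicE (memNset (wB : ~ B (f i) (X i w))) eqxx.
rewrite integral_sum_indic//; last by move=> f; exact: prodr_ge0.
under [in RHS]eq_bigr => i _.
  rewrite (_ : \int[P]_w _ = (\sum_k C k * fine (P (X i @^-1` B k)))%:E)%E; last first.
    by rewrite -integral_sum_indic//; apply: eq_integral => w _.
  over.
rewrite prodEFin bigA_distr_bigA; congr (_%:E); apply: eq_bigr => f _.
rewrite big_split/=; congr (_ * _).
rewrite /E Xind//.
rewrite (eq_bigr (fun i => (fine (P (X i @^-1` B (f i))))%:E)); last first.
  by move=> i _; rewrite fineK// fin_num_measure.
by rewrite prodEFin/=; apply: eq_bigl => i; rewrite inE.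
Qed.

Lemma integral_prod_le_eps (h : R -> R) (M : R) (m : nat) :
  measurable_fun setT h -> (forall i w, 0 <= h (X i w) <= 1) ->
  (forall i, \int[P]_w (h (X i w))%:E <= M%:E)%E ->
  (\int[P]_w (\prod_i h (X i w))%:E <= ((M + m.+1%:R^-1) ^+ n)%:E)%E.
Proof.
move=> mh h01 hM.
(* Rounding [h] up to the grid of mesh 1 / (m + 1) costs at most one mesh. The value h = 1 falls in
   the cell of index m + 1, hence m + 2 cells. *)
pose C (k : 'I_m.+2) : R := k.+1%:R / m.+1%:R.
pose B (k : 'I_m.+2) := [set x | k%:R <= m.+1%:R * h x < k.+1%:R].
have mh' : measurable_fun setT (fun x => m.+1%:R * h x).
  by apply: measurable_funM.
have mB k : measurable (B k).
  rewrite (_ : B k = (fun x => m.+1%:R * h x) @^-1` `[k%:R, k.+1%:R[%classic).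
    by rewrite -[X in measurable X]setTI; apply: mh' => //; exact: measurable_itv.
  by apply/seteqP; split=> x /=; rewrite in_itv.
have C0 k : 0 <= C k by rewrite divr_ge0.
have m0 : 0 < m.+1%:R :> R by rewrite ltr0n.
have stepE i w : exists2 k : 'I_m.+2, h (X i w) <= C k <= h (X i w) + m.+1%:R^-1 &
    \sum_k C k * \1_(B k) (X i w) = C k.
  have /andP[h0 h1] := h01 i w.
  have mh0 : 0 <= m.+1%:R * h (X i w) by rewrite mulr_ge0// ltW.
  have := truncn_itv mh0; set k := Num.truncn _ => kI.
  have km : (k < m.+2)%N.
    rewrite ltnS -(ler_nat R); move: kI => /andP[kl _].
    by rewrite (le_trans kl)// ler_piMr// ltW.
  exists (Ordinal km); rewrite /C/=.
    move: kI => /andP[kl ku].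
    rewrite ler_pdivlMr// mulrC (ltW ku)/=.
    by rewrite ler_pdivrMr// mulrDl mulVf ?gt_eqF// -natr1 lerD2r mulrC.
  rewrite (bigD1 (Ordinal km))//= big1 ?addr0.
    by rewrite indicE mem_set ?mulr1.
  move=> j jk; rewrite indicE memNset ?mulr0//= /B/= => jI.
  move: jk => /eqP; apply; apply: val_inj => /=; apply/eqP.
  move: kI jI => /andP[kl ku] /andP[jl ju].
  rewrite eqn_leq; apply/andP; split; rewrite -ltnS -(ltr_nat R).
    exact: le_lt_trans jl ku.
  exact: le_lt_trans kl ju.
pose s i w := \sum_k C k * \1_(B k) (X i w).
have ms i : measurable_fun setT (s i).
  apply: measurable_sum => k; apply: measurable_funM => //.
  by apply: measurableT_comp => //; exact: measurable_indic.
have mhX i : measurable_fun setT (fun w => h (X i w)).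
  exact: measurableT_comp.
have s0 i w : 0 <= s i w.
  by apply: sumr_ge0 => k _; rewrite mulr_ge0.
apply: (@le_trans _ _ (\int[P]_w (\prod_i s i w)%:E)%E).
  apply: ge0_le_integral => //.
  - by move=> w _; rewrite lee_fin prodr_ge0// => i _; have /andP[] := h01 i w.
  - apply/measurable_EFinP.
    by apply: (@measurable_prod _ _ _ _ _ _ (fun i w => h (X i w))) => i _.
  - by apply/measurable_EFinP; apply: (@measurable_prod _ _ _ _ _ _ s) => i _.
  move=> w _; rewrite lee_fin; apply: ler_prod => i _.
  have /andP[-> _]/= := h01 i w.
  by have [k /andP[hk _] e] := stepE i w; rewrite /s e.
rewrite integral_prod_step//.
have sM i : (\int[P]_w (s i w)%:E <= (M + m.+1%:R^-1)%:E)%E.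
  apply: (@le_trans _ _ (\int[P]_w ((h (X i w))%:E + (m.+1%:R^-1)%:E))%E).
    apply: ge0_le_integral => //.
    - by move=> w _; rewrite lee_fin.
    - exact/measurable_EFinP.
    - by apply/measurable_EFinP/measurable_funD.
    move=> w _; rewrite -EFinD lee_fin.
    by have [k /andP[_ hk] e] := stepE i w; rewrite /s e.
  rewrite ge0_integralD//; last 2 first.
  - by move=> w _; rewrite lee_fin; have /andP[] := h01 i w.
  - exact/measurable_EFinP.
  by rewrite integral_probability_cst EFinD leeD2r.
have fs i : (\int[P]_w (s i w)%:E)%E \is a fin_num.
  rewrite ge0_fin_numE; last by apply: integral_ge0 => w _; rewrite lee_fin.
  by rewrite (le_lt_trans (sM i))// ltry.
rewrite (eq_bigr (fun i => (fine (\int[P]_w (s i w)%:E)%E)%:E)); last first.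
  by move=> i _; rewrite fineK.
rewrite prodEFin lee_fin -[n in _ ^+ n]card_ord -prodr_const; apply: ler_prod => i _.
rewrite fine_ge0/=; last by apply: integral_ge0 => w _; rewrite lee_fin.
by rewrite -lee_fin fineK.
Qed.

Lemma integral_prod_le (h : R -> R) (M : R) :
  measurable_fun setT h -> (forall i w, 0 <= h (X i w) <= 1) ->
  (forall i, \int[P]_w (h (X i w))%:E <= M%:E)%E ->
  (\int[P]_w (\prod_i h (X i w))%:E <= (M ^+ n)%:E)%E.
Proof.
move=> mh h01 hM; have H m := @integral_prod_le_eps h M m mh h01 hM.
set I := (\int[P]_w _)%E in H *.
have I0 : (0 <= I)%E.
  by apply: integral_ge0 => w _; rewrite lee_fin prodr_ge0// => i _; have /andP[] := h01 i w.
have fI : I \is a fin_num by rewrite ge0_fin_numE// (le_lt_trans (H 0%N))// ltry.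
rewrite -(fineK fI) lee_fin leNgt; apply/negP => Mr.
(* The mesh now tends to 0: if the integral exceeded M^n, it would still exceed (M + 1 / (m + 1))^n
   for some m. The sign turns this into the lower bound handled by [continuous_gt_ball]. *)
have cX : {for M, continuous (fun y : R => - y ^+ n)}.
  by apply: cvgN; exact: exprn_continuous.
have [|e e0 He] := @continuous_gt_ball _ _ _ (- fine I) cX; first by rewrite ltrN2.
have [m me] : exists m : nat, m.+1%:R^-1 < e.
  have [m] := ltr_add_invr e0.
  by rewrite add0r => ?; exists m.
have := He (M + m.+1%:R^-1); rewrite opprD addNKr normrN ger0_norm ?invr_ge0// => /(_ me).
by rewrite ltrN2 ltNge -lee_fin fineK// H.
Qed.

End iid_products.
End independent_products.

(** * Exponential moments and tail bounds *)

Lemma phi_level_tilt (R : realType) (c p : R) : 0 < c -> 0 < p < 1 ->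
  (exists2 w, 0 <= w < p & c < phi w p) ->
  exists w0 t, [/\ 0 < t, forall w, 0 <= w -> w < p -> c < phi w p -> w <= w0 &
    t * w0 + ln (1 - p + p * expR (- t)) <= - c].
Proof.
move=> c0 pI [w /andP[w0 wp] cw]; move: (pI) => /andP[p0 p1].
have q0 : 0 < 1 - p by lra.
have c0p : c < - ln (1 - p).
  rewrite (lt_le_trans cw)// (le_trans (phi_antitone (lexx 0) w0 (ltW wp) pI))//.
  by rewrite /phi mul0r addr0 subr0 mul1r div1r lnV.
(* Treating w = 0 apart lets the intermediate value theorem work on a segment inside (0, 1), where
   [phi] is continuous in w. *)
have [[w1 w1p cw1]|none] := pselect (exists2 w, 0 < w < p & c < phi w p).
  have /andP[w10 w1p'] := w1p.
  have [||x] := @IVT R (fun x => phi x p) w1 p c (ltW w1p').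
  - apply: continuous_in_subspaceT => x; rewrite inE/= in_itv/= => /andP[w1x xp].
    by apply: continuous_phi_left => //; lra.
  - by rewrite phi_id// ge_min le_max (ltW cw1) (ltW c0) orbT.
  rewrite in_itv/= => /andP[w1x xp] phix.
  have xp' : x < p.
    by rewrite lt_neqAle xp andbT; apply: contraTneq c0 => xE; rewrite -phix xE phi_id// ltxx.
  have x0 : 0 < x by lra.
  have x1 : 0 < 1 - x by lra.
  (* With phi x p = c, the optimal tilt is the difference of the logits of p and x; the exponent is
     then exactly - phi x p. *)
  exists x, (ln (p * (1 - x) / (x * (1 - p)))); split.
  - by apply: ln_gt0; rewrite ltr_pdivlMr ?mulr_gt0//; nra.
  - move=> y y0 yp cy; rewrite leNgt; apply/negP => xy.
    have := phi_antitone (ltW x0) (ltW xy) (ltW yp) pI; rewrite phix; lra.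
  - have y0 : 0 < p * (1 - x) / (x * (1 - p)) by rewrite divr_gt0// mulr_gt0.
    rewrite expRN lnK ?posrE//.
    have -> : 1 - p + p * (p * (1 - x) / (x * (1 - p)))^-1 = (1 - p) / (1 - x).
      by field; rewrite !gt_eqF.
    rewrite ln_divE ?mulr_gt0// ln_divE// (@lnM _ p) ?posrE// (@lnM _ x) ?posrE//.
    by rewrite -phix /phi !ln_divE//; lra.
have e1 : 1 - p < expR (- c) by rewrite -[ltLHS]lnK ?posrE// ltr_expR; lra.
have e2 : expR (- c) < 1 by rewrite expR_lt1; lra.
(* Only w = 0 remains, so t need only satisfy 1 - p + p exp(- t) = exp(- c); a is exp(- t), and
   [c0p] makes it positive. *)
pose a := (expR (- c) - (1 - p)) / p.
have a0 : 0 < a by rewrite divr_gt0//; lra.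
have a1 : a < 1 by rewrite ltr_pdivrMr//; lra.
exists 0, (- ln a); split.
- by rewrite oppr_gt0 ln_lt0 ?a0.
- move=> y y0 yp cy; rewrite leNgt; apply/negP => y0'.
  by apply: none; exists y => //; rewrite y0'.
- rewrite mulr0 add0r opprK lnK ?posrE//.
  have -> : 1 - p + p * a = expR (- c) by rewrite /a; field; rewrite gt_eqF.
  by rewrite expRK.
Qed.

(** Both sides agree at t = 0, and the t-derivative of the left side, y (exp(- t) - exp(- t y)), is
    nonpositive because y <= 1. *)
Lemma expR_le_chord (R : realType) (t y : R) : 0 <= t -> 0 <= y <= 1 ->
  expR (- t * y) + (1 - expR (- t)) * y <= 1.
Proof.
move=> t0 /andP[y0 y1].
pose f (x : R) := - (expR (- x * y) + (1 - expR (- x)) * y).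
have : f 0 <= f t.
  apply: (@le_is_derive R f (fun x => y * (expR (- x * y) - expR (- x)))) => // x /andP[x0 _].
    have h1 : is_derive x 1 (fun x : R => - x * y) (- y).
      by apply: is_derive_eq; rewrite /GRing.scale/=; ring.
    have h2 := @is_derive1_comp R (@expR R) _ x _ _ (is_derive_expR _) h1.
    have h3 := @is_derive1_comp R (@expR R) _ x _ _ (is_derive_expR _) (is_deriveNid x 1).
    rewrite /f; apply: is_derive_eq.
    by rewrite /GRing.scale/=; ring.
  by rewrite mulr_ge0// subr_ge0 ler_expR; nra.
rewrite /f oppr0 mul0r expR0; lra.
Qed.

(* The parabola agrees with expR (- t * s) at s = 0 and is tangent to it
   at s = 1. *)
Lemma expR_le_parabola (R : realType) (t s : R) : 0 <= t -> 0 <= s ->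
  expR (- t * s) + (2 * (1 - expR (- t)) - t * expR (- t)) * s <=
  1 + (1 - expR (- t) - t * expR (- t)) * s ^+ 2.
Proof.
move=> t0 s0.
pose f (x : R) := 1 + (1 - expR (- x) - x * expR (- x)) * s ^+ 2 -
  (expR (- x * s) + (2 * (1 - expR (- x)) - x * expR (- x)) * s).
suff : f 0 <= f t.
  by rewrite /f oppr0 !mul0r expR0 !subr0 subrr mulr0 !mul0r !addr0 subrr subr_ge0.
(* The derivative is taken in t; its sign comes from exp(- a) >= 1 - a at a = x (s - 1). *)
pose df (x : R) := s * expR (- x) * (expR (- x * (s - 1)) - 1 + x * (s - 1)).
apply: (@le_is_derive R f df) => // x /andP[x0 _].
  have h1 : is_derive x 1 (fun x : R => - x * s) (- s).
    by apply: is_derive_eq; rewrite /GRing.scale/=; ring.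
  have h2 := @is_derive1_comp R (@expR R) _ x _ _ (is_derive_expR _) h1.
  have h3 := @is_derive1_comp R (@expR R) _ x _ _ (is_derive_expR _) (is_deriveNid x 1).
  rewrite /f /df.
  have -> : s * expR (- x) * (expR (- x * (s - 1)) - 1 + x * (s - 1)) =
    s * expR (- x * s) - s * expR (- x) * (1 - x * (s - 1)).
    rewrite (_ : - x * s = - x + - x * (s - 1)); last by ring.
    by rewrite expRD; ring.
  apply: is_derive_eq.
  by rewrite /GRing.scale/=; ring.
rewrite /df mulr_ge0// ?mulr_ge0 ?expR_ge0//.
have := expR_ge1Dx (- x * (s - 1)); lra.
Qed.

Section tail_bounds.
Context (R : realType) (d : measure_display) (T : measurableType d)
  (P : probability T R).

(** Keeping the subtracted term on the left makes both sides of the pointwise bound nonnegative, so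
    the integral is additive on each. *)
Lemma integral_le_affine (f g k : T -> R) (a b G K : R) :
  measurable_fun setT f -> measurable_fun setT g -> measurable_fun setT k ->
  (forall w, 0 <= f w) -> (forall w, 0 <= g w) -> (forall w, 0 <= k w) ->
  0 <= a -> 0 <= b ->
  (\int[P]_w (g w)%:E = G%:E)%E -> (\int[P]_w (k w)%:E = K%:E)%E ->
  (forall w, f w + a * g w <= 1 + b * k w) ->
  (\int[P]_w (f w)%:E <= (1 + b * K - a * G)%:E)%E.
Proof.
move=> mf mg mk f0 g0 k0 a0 b0 IG IK le_fgk.
have /= := @ge0_le_integral _ _ _ P setT measurableT
  (fun w => (f w)%:E + a%:E * (g w)%:E)%E (fun w => 1%:E + b%:E * (k w)%:E)%E.
rewrite ge0_integralD//; last 4 first.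
- by move=> w _; rewrite lee_fin.
- exact/measurable_EFinP.
- by move=> w _; rewrite -EFinM lee_fin mulr_ge0.
- by apply/measurable_EFinP; exact: measurable_funM.
rewrite ge0_integralD//; last 2 first.
- by move=> w _; rewrite -EFinM lee_fin mulr_ge0.
- by apply/measurable_EFinP; exact: measurable_funM.
rewrite !ge0_integralZl_EFin//; last 4 first.
- by move=> w _; rewrite lee_fin.
- exact/measurable_EFinP.
- by move=> w _; rewrite lee_fin.
- exact/measurable_EFinP.
rewrite IG IK integral_probability_cst.
rewrite -!EFinM EFinB leeBrDr//; apply.
- by move=> w _; rewrite -EFinM -EFinD lee_fin addr_ge0// mulr_ge0.
- by apply/measurable_EFinP/measurable_funD => //; exact: measurable_funM.
- by apply/measurable_EFinP/measurable_funD => //; exact: measurable_funM.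
- by move=> w _; rewrite -!EFinM -!EFinD lee_fin.
Qed.

Section sample.
Variables (n : nat) (X : 'I_n -> {RV P >-> R}).
Hypotheses (n0 : (0 < n)%N) (Xind : mutually_independent X).
Variable c : R.
Hypothesis c0 : 0 < c.

Let mean (h : R -> R) (w : T) : R := sample_mean (fun i => h (X i w)).

Lemma measurable_sample_mean (h : R -> R) : measurable_fun setT h ->
  measurable_fun setT (mean h).
Proof.
move=> mh; apply: measurable_funM => //.
by apply: measurable_sum => i; exact: measurableT_comp.
Qed.

(** The deviation event is covered by a measurable A, either empty or a sublevel set of the mean, to
    which the exponential Markov inequality applies. *)
Lemma chernoff_phi (h : R -> R) (p : R) : measurable_fun setT h ->
  (forall i w, 0 <= h (X i w)) -> 0 < p < 1 ->
  (forall t i, 0 < t ->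
    (\int[P]_w (expR (- t * h (X i w)))%:E <= (1 - p + p * expR (- t))%:E)%E) ->
  exists A, [/\ measurable A,
    forall w, mean h w < p -> c < phi (mean h w) p -> A w &
    (P A <= (expR (- (n%:R * c)))%:E)%E].
Proof.
move=> mh h0 pI mgf.
have nR0 : 0 < n%:R :> R by rewrite ltr0n.
have mean0 w : 0 <= mean h w.
  by rewrite mulr_ge0 ?invr_ge0 ?ler0n// sumr_ge0.
have [ex|none] := pselect (exists2 w, 0 <= w < p & c < phi w p); last first.
  exists set0; split=> //; last by rewrite measure0 lee_fin expR_ge0.
  by move=> w wp cw; apply: none; exists (mean h w) => //; rewrite mean0.
have [w0 [t [t0 Hw0 Ht]]] := phi_level_tilt c0 pI ex.
pose A := [set w | mean h w <= w0].
have mA : measurable A.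
  rewrite (_ : A = mean h @^-1` `]-oo, w0]%classic); last first.
    by apply/seteqP; split=> w /=; rewrite in_itv.
  rewrite -[X in measurable X]setTI.
  by apply: measurable_sample_mean => //; exact: measurable_itv.
exists A; split=> //; first by move=> w wp cw; exact: Hw0.
set M := 1 - p + p * expR (- t).
have M0 : 0 < M by have := expR_gt0 (- t); rewrite /M; move: pI => /andP[]; nra.
have I1 : (\int[P]_w (\prod_i expR (- t * h (X i w)))%:E <= (M ^+ n)%:E)%E.
  apply: (@integral_prod_le _ _ _ _ _ _ Xind (fun x => expR (- t * h x))).
  - by apply: measurableT_comp => //; exact: measurable_funM.
  - move=> i w; rewrite expR_ge0/= -[leRHS]expR0 ler_expR.
    by have := h0 i w; nra.
  - by move=> i; exact: mgf.
(* A lower bound on A for the product of the exponentials. *)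
pose a := expR (- (t * (n%:R * w0))).
have a0 : 0 < a by exact: expR_gt0.
have I2 : (a%:E * P A <= \int[P]_w (\prod_i expR (- t * h (X i w)))%:E)%E.
  have -> : (a%:E * P A = \int[P]_w (a%:E * (\1_A w)%:E))%E.
    rewrite ge0_integralZl_EFin//; last exact: ltW.
    - by rewrite integral_indic// setIT.
    - by apply/measurable_EFinP; exact: measurable_indic.
  apply: ge0_le_integral => //.
  - by move=> w _; rewrite -EFinM lee_fin mulr_ge0// ltW.
  - by apply/measurable_EFinP/measurable_funM => //; exact: measurable_indic.
  - apply/measurable_EFinP.
    apply: (@measurable_prod _ _ _ _ _ _ (fun i w => expR (- t * h (X i w)))) => i _.
    by apply: measurableT_comp => //; apply: measurable_funM => //; exact: measurableT_comp.
  move=> w _; rewrite -EFinM lee_fin -expR_sum indicE.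
  have [/set_mem wA|wA] := boolP (w \in A); last by rewrite mulr0 expR_ge0.
  rewrite mulr1 ler_expR -mulr_sumr.
  have : \sum_(i < n) h (X i w) <= n%:R * w0 by rewrite -ler_pdivrMl.
  rewrite mulNr lerN2 => ?; exact: ler_wpM2l (ltW t0) _ _ _.
have fP : P A \is a fin_num by rewrite fin_num_measure.
have := le_trans I2 I1; rewrite -(fineK fP) -EFinM !lee_fin.
rewrite -ler_pdivlMl// /a -expRN opprK => /le_trans; apply.
rewrite -[M in M ^+ n]lnK ?posrE// -expRM_natl -expRD ler_expR -/M.
rewrite (_ : _ + _ = n%:R * (t * w0 + ln M)); last by ring.
rewrite -mulrN; exact: ler_wpM2l (ltW nR0) _ _ _.
Qed.

(** Bias-variance decomposition; it turns [W] into a sample mean of squares, the form required by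
    [chernoff_phi]. *)
Lemma sample_var_shift (x : 'I_n -> R) (m : R) :
  sample_var x + (sample_mean x - m) ^+ 2 = sample_mean (fun i => (x i - m) ^+ 2).
Proof.
have nR0 : n%:R != 0 :> R by rewrite pnatr_eq0 -lt0n.
have S : \sum_(i < n) x i = n%:R * sample_mean x.
  by rewrite /sample_mean mulrA mulfV// mul1r.
rewrite /sample_var {3}/sample_mean; move: (sample_mean x) S => z S.
have e b : \sum_(i < n) (x i - b) ^+ 2 =
    \sum_(i < n) x i ^+ 2 - 2 * b * (n%:R * z) + n%:R * b ^+ 2.
  rewrite -S mulr_sumr -sumrB.
  rewrite (_ : n%:R * b ^+ 2 = \sum_(i < n) b ^+ 2); last first.
    by rewrite sumr_const card_ord mulr_natl.
  by rewrite -big_split/=; apply: eq_bigr => i _; ring.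
by rewrite !e; field.
Qed.

(** [g] will be the identity or x -> 1 - x, one choice for each tail. *)
Variables (g : R -> R) (m v : R).
Hypotheses (mg : measurable_fun setT g) (g01 : forall i w, 0 <= g (X i w) <= 1)
  (m01 : 0 < m < 1) (v0 : 0 < v)
  (gm : forall i, (\int[P]_w (g (X i w))%:E = m%:E)%E)
  (gv : forall i, (\int[P]_w ((g (X i w) - m) ^+ 2)%:E = v%:E)%E).

Let mgX i : measurable_fun setT (fun w => g (X i w)).
Proof. exact: measurableT_comp. Qed.

Lemma integral_sqr i : (\int[P]_w ((g (X i w)) ^+ 2)%:E = (v + m ^+ 2)%:E)%E.
Proof.
have /andP[m0 m1] := m01.
(* The square is expanded with only nonnegative terms on each side. *)
have : (\int[P]_w (((g (X i w)) ^+ 2)%:E + (m ^+ 2)%:E) =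
        \int[P]_w (((g (X i w) - m) ^+ 2)%:E + (2 * m)%:E * (g (X i w))%:E))%E.
  by apply: eq_integral => w _; rewrite -EFinM -!EFinD; congr (_%:E); ring.
have mb : measurable_fun setT (fun w => (g (X i w) - m) ^+ 2).
  by apply: measurable_funX; exact: measurable_funB.
have g0 w : 0 <= g (X i w) by have /andP[] := g01 i w.
rewrite ge0_integralD//; last 3 first.
- by move=> w _; rewrite lee_fin sqr_ge0.
- by apply/measurable_EFinP; exact: measurable_funX.
- by move=> w _; rewrite lee_fin sqr_ge0.
rewrite ge0_integralD//; last 4 first.
- by move=> w _; rewrite lee_fin sqr_ge0.
- exact/measurable_EFinP.
- by move=> w _; rewrite -EFinM lee_fin mulr_ge0//; lra.
- by apply/measurable_EFinP; exact: measurable_funM.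
rewrite ge0_integralZl_EFin//; last 3 first.
- by move=> w _; rewrite lee_fin.
- exact/measurable_EFinP.
- by rewrite mulr_ge0//; lra.
rewrite gm gv integral_probability_cst -EFinM -EFinD.
by case: (\int[P]_w _)%E => [r| |]// [e]; congr (_%:E); lra.
Qed.

(** From g^2 <= g on [0, 1]. This makes the true variance an admissible theta at nu = m. *)
Lemma variance_le : v <= m * (1 - m).
Proof.
have i : 'I_n := Ordinal n0.
have : ((v + m ^+ 2)%:E <= m%:E)%E.
  rewrite -(integral_sqr i) -(gm i); apply: ge0_le_integral => //.
  - by move=> w _; rewrite lee_fin sqr_ge0.
  - by apply/measurable_EFinP; exact: measurable_funX.
  - exact/measurable_EFinP.
  by move=> w _; rewrite lee_fin; have := g01 i w; nra.
by rewrite lee_fin; lra.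
Qed.

Lemma sample_var_tail : exists A, [/\ measurable A,
  forall w, c < left_phi (sample_var (fun i => g (X i w)) + (mean g w - m) ^+ 2) v -> A w &
  (P A <= (expR (- (n%:R * c)))%:E)%E].
Proof.
have /andP[m0 m1] := m01.
have v1 := variance_le.
have [|i w||t i t0|A [mA HA PA]] := @chernoff_phi (fun x => (g x - m) ^+ 2) v.
- by apply: measurable_funX; exact: measurable_funB.
- exact: sqr_ge0.
- by rewrite v0 (le_lt_trans v1)//; nra.
(* The chord bound has no quadratic term, hence b = 0 and k = 0. *)
- rewrite (_ : 1 - v + v * expR (- t) = 1 + 0 * 0 - (1 - expR (- t)) * v); last by ring.
  apply: (@integral_le_affine _ (fun w => (g (X i w) - m) ^+ 2) (cst 0)) => //.
  - apply: measurableT_comp => //; apply: measurable_funM => //.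
    by apply: measurable_funX; exact: measurable_funB.
  - by apply: measurable_funX; exact: measurable_funB.
  - by move=> w; rewrite sqr_ge0.
  - by rewrite subr_ge0 expR_le1; lra.
  - exact: integral0.
  - move=> w; rewrite mul0r addr0; apply: expR_le_chord; first exact: ltW.
    by rewrite sqr_ge0/=; have := g01 i w; nra.
exists A; split=> // w; rewrite /mean sample_var_shift => cw; apply: HA.
  rewrite ltNge; apply/negP => vw; move: cw; rewrite /left_phi (ltNge _ v) vw mulr0.
  by move=> /(lt_trans c0); rewrite ltxx.
move: cw; rewrite /left_phi; case: (ltP _ v) => _; rewrite ?mulr1//.
by rewrite mulr0 => /(lt_trans c0); rewrite ltxx.
Qed.

Lemma sample_mean_tail : exists A, [/\ measurable A,
  forall w, mean g w < m -> c < varphi (mean g w) m v -> A w &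
  (P A <= (expR (- (n%:R * c)))%:E)%E].
Proof.
have /andP[m0 m1] := m01.
pose b := m + v / m.
have mb : m < b by rewrite ltrDl divr_gt0.
have b0 : 0 < b by lra.
have meanE w : mean (fun x => g x / b) w = mean g w / b.
  by rewrite /mean /sample_mean -mulr_suml mulrA.
have [|i w||t i t0|A [mA HA PA]] := @chernoff_phi (fun x => g x / b) (m / b).
- exact: measurable_funM.
- by rewrite divr_ge0 ?(ltW b0)//; have /andP[] := g01 i w.
- by rewrite divr_gt0//= ltr_pdivrMr// mul1r.
- have e0 := expR_gt0 (- t).
  (* [e1] and [e2] make both coefficients of the parabola nonnegative. *)
  have e1 : expR (- t) * (1 + t) <= 1.
    rewrite expRN mulrC ler_pdivrMr ?expR_gt0// mul1r; exact: expR_ge1Dx.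
  have e2 : expR (- t) <= 1 by rewrite expR_le1; lra.
  (* Because the second moment v + m^2 equals m b, the integrated parabola is exactly the moment
     generating function of a Bernoulli law of mean m / b. *)
  rewrite (_ : 1 - m / b + m / b * expR (- t) =
    1 + (1 - expR (- t) - t * expR (- t)) / b ^+ 2 * (v + m ^+ 2) -
    (2 * (1 - expR (- t)) - t * expR (- t)) / b * m); last first.
    have -> : v + m ^+ 2 = m * b by rewrite /b; field; rewrite gt_eqF.
    by field; rewrite gt_eqF.
  apply: (@integral_le_affine _ (fun w => g (X i w)) (fun w => (g (X i w)) ^+ 2)) => //.
  - apply: measurableT_comp => //; apply: measurable_funM => //.
    exact: measurable_funM.
  - exact: measurable_funX.
  - by move=> w; have /andP[] := g01 i w.
  - by move=> w; rewrite sqr_ge0.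
  - by apply: divr_ge0; [lra|exact: ltW].
  - by apply: divr_ge0; [lra|rewrite sqr_ge0].
  - exact: integral_sqr.
  - move=> w; have := @expR_le_parabola _ t (g (X i w) / b) (ltW t0).
    rewrite divr_ge0 ?(ltW b0)//; last by have /andP[] := g01 i w.
    move=> /(_ isT); rewrite expr_div_n !mulrA.
    by rewrite ![_ / _ * _]mulrAC.
exists A; split=> // w wm cw; apply: HA; rewrite meanE.
  by rewrite ltr_pM2r// invr_gt0.
rewrite varphiE// in cw.
by rewrite mulr_ge0 ?invr_ge0 ?ler0n// sumr_ge0// => i _; have /andP[] := g01 i w.
Qed.

End sample.
End tail_bounds.

(** * From the limits to the set [upper_set] *)

Section confidence_limits.
Variables (R : realType) (n : nat) (x : 'I_n -> R) (delta mu : R).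
Hypotheses (n0 : (0 < n)%N) (x01 : forall i, 0 <= x i <= 1)
  (delta01 : 0 < delta < 1) (mu01 : 0 < mu < 1).

Let c : R := ln (3 / delta) / n%:R.

Lemma sample_mean_itv : 0 <= sample_mean x <= 1.
Proof.
have nR0 : 0 < n%:R :> R by rewrite ltr0n.
rewrite /sample_mean mulr_ge0 ?invr_ge0 ?ler0n//=; last first.
  by rewrite sumr_ge0// => i _; have /andP[] := x01 i.
rewrite ler_pdivrMl// mulr1 -[n in n%:R]card_ord -sumr_const ler_sum// => i _.
by have /andP[] := x01 i.
Qed.

Lemma sample_var_ge0 : 0 <= sample_var x.
Proof.
by rewrite /sample_var mulr_ge0 ?invr_ge0 ?ler0n// sumr_ge0// => i _; exact: sqr_ge0.
Qed.

Lemma level_gt0 : 0 < c.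
Proof.
have /andP[d0 d1] := delta01.
by rewrite divr_gt0 ?ltr0n// ln_gt0// ltr_pdivlMr//; lra.
Qed.

Lemma upper_limit_ltP : upper_limit delta x < mu <->
  exists2 nu, nu < mu & upper_set c (sample_mean x) (sample_var x) nu.
Proof.
have /andP[z0 z1] := sample_mean_itv; have /andP[mu0 mu1] := mu01.
rewrite /upper_limit -/(upper_set c (sample_mean x) (sample_var x)).
case: eqVneq => [zE|zN].
  split=> [|[nu _ [/andP[]]]]; first lra.
  by rewrite zE => ? ?; lra.
(* Needed because [inf] of the empty set is 0, which lies below mu. *)
have ne : upper_set c (sample_mean x) (sample_var x) !=set0.
  by apply: upper_set_neq0; [exact: level_gt0|rewrite z0 lt_neqAle zN].
have lb : has_lbound (upper_set c (sample_mean x) (sample_var x)).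
  by exists 0 => nu [/andP[? _] _]; lra.
split=> [h|[nu numu hnu]]; last by apply: le_lt_trans numu; exact: ge_inf.
by have [nu hnu ?] := inf_lt ne h; exists nu.
Qed.

Lemma lower_limit_gtP : mu < lower_limit delta x <->
  exists2 nu, nu < 1 - mu & upper_set c (1 - sample_mean x) (sample_var x) nu.
Proof.
have /andP[z0 z1] := sample_mean_itv; have /andP[mu0 mu1] := mu01.
rewrite /lower_limit; set S := mkset _.
(* The reflection nu -> 1 - nu preserves nu (1 - nu) and [W], and turns [psi] into [varphi]. *)
have SE nu : S nu <-> upper_set c (1 - sample_mean x) (sample_var x) (1 - nu).
  rewrite /S /upper_set /psi /W /left_phi/=.
  have -> : 1 - sample_mean x - (1 - nu) = - (sample_mean x - nu) by ring.
  have -> : (1 - nu) * (1 - (1 - nu)) = nu * (1 - nu) by ring.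
  have -> : (1 - sample_mean x < 1 - nu < 1) = (0 < nu < sample_mean x).
    by rewrite andbC; congr andb; apply/idP/idP => ?; lra.
  by rewrite sqrrN.
case: eqVneq => [zE|zN].
  split=> [|[nu _ [/andP[]]]]; first lra.
  by rewrite zE => ? ?; lra.
have ub : has_ubound S by exists 1 => nu [/andP[_ ?] _]; lra.
split=> [h|[nu numu hnu]].
  (* Here the default value helps: [sup] of the empty set is 0, not above mu. *)
  have ne : S !=set0.
    by apply: contrapT => /nonemptyPn S0; move: h; rewrite S0 sup0; lra.
  have [nu hnu munu] := sup_gt ne h.
  by exists (1 - nu); [lra|exact/SE].
apply: (@lt_le_trans _ _ (1 - nu)); first lra.
by apply: ub_le_sup => //; apply/SE; rewrite opprB addrCA subrr addr0.
Qed.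

End confidence_limits.

Lemma sample_meanB1 (R : realType) (n : nat) (x : 'I_n -> R) : (0 < n)%N ->
  sample_mean (fun i => 1 - x i) = 1 - sample_mean x.
Proof.
move=> n0; have nR0 : n%:R != 0 :> R by rewrite pnatr_eq0 -lt0n.
by rewrite /sample_mean sumrB sumr_const card_ord mulrBr mulVf.
Qed.

(** * Measurability of the coverage event *)

Lemma bigcup_measurable_rat (d : measure_display) (T : measurableType d)
    (D : set rat) (F : rat -> set T) :
  (forall q, D q -> measurable (F q)) -> measurable (\bigcup_(q in D) F q).
Proof.
move=> mF; rewrite bigcup_mkcond; apply: bigcupT_measurable_rat => q.
by case: ifPn => // /set_mem; exact: mF.
Qed.

Lemma measurable_upper_set_below (R : realType) (d : measure_display)
    (T : measurableType d) (Z V : T -> R) (c mu : R) :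
  measurable_fun setT Z -> measurable_fun setT V -> 0 < c -> mu < 1 ->
  (forall w, 0 <= Z w) -> (forall w, 0 <= V w) ->
  measurable [set w | exists2 nu, nu < mu & upper_set c (Z w) (V w) nu].
Proof.
move=> mZ mV c0 mu1 Z0 V0.
have mlt (f : T -> R) (r : R) : measurable_fun setT f -> measurable [set w | r < f w].
  move=> mf; rewrite (_ : mkset _ = f @^-1` `]r, +oo[%classic); last first.
    by apply/seteqP; split=> w /=; rewrite in_itv/= andbT.
  by rewrite -[X in measurable X]setTI; apply: mf => //; exact: measurable_itv.
have mvarphi nu theta : measurable_fun setT (fun w => varphi (Z w) nu theta).
  have mq : measurable_fun setT (fun w => Z w * nu / (nu ^+ 2 + theta)).
    by apply: measurable_funM => //; exact: measurable_funM.
  apply: measurable_funD; apply: measurable_funM => //.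
  - exact: measurable_funB.
  - apply: measurableT_comp; first exact: measurable_ln.
    apply: measurable_funM => //; apply: measurable_funD => //.
    by apply: measurable_funM => //; exact: measurable_funB.
  - apply: measurableT_comp; first exact: measurable_ln.
    exact: measurable_funM.
have mleft (U : T -> R) theta : measurable_fun setT U ->
    measurable_fun setT (fun w => left_phi (U w) theta).
  move=> mU; apply: measurable_funM.
    apply: measurable_funD; apply: measurable_funM => //.
    - exact: measurable_funB.
    - apply: measurableT_comp; first exact: measurable_ln.
      by apply: measurable_funM => //; exact: measurable_funB.
    - apply: measurableT_comp; first exact: measurable_ln.
      exact: measurable_funM.
  rewrite (_ : (fun w => _) = \1_[set w | U w < theta]).
    apply: measurable_indic.
    rewrite (_ : mkset _ = [set w | - theta < - U w]).
      by apply: mlt; exact: measurableT_comp.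
    by apply/seteqP; split=> w /=; rewrite ltrN2.
  apply/funext => w; rewrite indicE; congr (_%:R); congr nat_of_bool.
  by apply/idP/idP => [?|/set_mem//]; rewrite mem_set.
(* By upward closure, any rational between nu and mu can replace nu. *)
rewrite (_ : mkset _ = \bigcup_(q in [set q : rat | ratr q < mu])
  [set w | upper_set c (Z w) (V w) (ratr q)]); last first.
  apply/seteqP; split=> w /= [nu].
    move=> numu hnu; have [q] := rat_in_itvoo numu; rewrite in_itv/= => /andP[nuq qmu].
    exists q => //=; have := @upper_set_upclosed _ c (Z w) (V w) nu (ratr q) (Z0 w) (V0 w).
    by rewrite !inE; apply=> //; [exact: ltW|exact: lt_trans mu1].
  by move=> numu hnu; exists (ratr nu).
apply: bigcup_measurable_rat => q /= qmu; have q1 := lt_trans qmu mu1.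
set nu : R := ratr q in q1 qmu *.
rewrite (_ : mkset _ = [set w | - nu < - Z w] `&`
  ([set w | c < varphi (Z w) nu (nu * (1 - nu))] `|`
   \bigcup_(r in [set r : rat | 0 < (ratr r : R) <= nu * (1 - nu)])
     ([set w | c < varphi (Z w) nu (ratr r)] `&`
      [set w | c < left_phi (V w + (Z w - nu) ^+ 2) (ratr r)]))); last first.
  apply/seteqP; split=> w /=.
    move=> h; have /andP[Znu _] := h.1; split; first by rewrite ltrN2.
    move/(@upper_set_ratP _ _ _ _ _ c0 (Z0 w) (V0 w)) : h; rewrite Znu => /(_ q1).
    by case=> [|[r [rI r1 r2]]]; [left|right; exists r].
  rewrite ltrN2 => -[Znu h]; apply/upper_set_ratP => //; first by rewrite Znu.
  by case: h => [|[r rI [r1 r2]]]; [left|right; exists r].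
apply: measurableI; first by apply: mlt; exact: measurableT_comp.
apply: measurableU; first exact: mlt.
apply: bigcup_measurable_rat => r _; apply: measurableI; apply: mlt => //.
apply: mleft; apply: measurable_funD => //; apply: measurable_funX.
exact: measurable_funB.
Qed.

(** * Coverage of the confidence interval *)

Theorem theorem3 (R : realType) (d : measure_display) (T : measurableType d)
    (P : probability T R) (n : nat) (X : 'I_n -> {RV P >-> R})
    (mu sigma delta : R)
    (hn : (0 < n)%N)
    (hiid : iid X)
    (hX01 : forall (i : 'I_n) (w : T), 0 <= X i w <= 1)
    (hmean : forall i : 'I_n, ('E_P[X i])%E = mu%:E)
    (hvar : forall i : 'I_n, ('V_P[X i])%E = (sigma ^+ 2)%:E)
    (hmu : 0 < mu < 1)
    (hsigma : 0 < sigma ^+ 2)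
    (hdelta : 0 < delta < 1) :
  (P [set w : T | (lower_limit delta (fun i => X i w) <= mu
                  <= upper_limit delta (fun i => X i w))%R]
   >= (1 - delta)%:E)%E.
Proof.
have [Xind _] := hiid; have /andP[mu0 mu1] := hmu; have /andP[d0 d1] := hdelta.
set c : R := ln (3 / delta) / n%:R.
have c0 : 0 < c by exact: level_gt0.
pose z w := sample_mean (fun i => X i w).
pose v w := sample_var (fun i => X i w).
have zI w : 0 <= z w <= 1 by exact: sample_mean_itv.
have v0 w : 0 <= v w by exact: sample_var_ge0.
have Imu i : (\int[P]_w (X i w)%:E = mu%:E)%E by rewrite -expectation_def hmean.
have Ivar i : (\int[P]_w ((X i w - mu) ^+ 2)%:E = (sigma ^+ 2)%:E)%E.
  rewrite -(hvar i) /variance unlock hmean/= unlock.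
  by apply: eq_integral => w _.
have nu01 : 0 < 1 - mu < 1 by lra.
have mB1 : measurable_fun setT (fun x : R => 1 - x) by exact: measurable_funB.
have ImuB1 i : (\int[P]_w (1 - X i w)%:E = (1 - mu)%:E)%E.
  have : (\int[P]_w ((1 - X i w)%:E + (X i w)%:E) = 1%:E)%E.
    rewrite -[RHS](integral_probability_cst P); apply: eq_integral => w _.
    by rewrite -EFinD subrK.
  rewrite ge0_integralD//; first last.
  - by apply/measurable_EFinP; exact: measurable_funP.
  - by move=> w _; rewrite lee_fin; have /andP[] := hX01 i w.
  - by apply/measurable_EFinP; exact: (measurableT_comp mB1).
  - by move=> w _; rewrite lee_fin subr_ge0; have /andP[] := hX01 i w.
  by rewrite Imu; case: (\int[P]_w _)%E => [r| |]// [e]; congr (_%:E); lra.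
have IvarB1 i : (\int[P]_w ((1 - X i w - (1 - mu)) ^+ 2)%:E = (sigma ^+ 2)%:E)%E.
  by rewrite -(Ivar i); apply: eq_integral => w _; congr (_%:E); ring.
have B01 i w : 0 <= 1 - X i w <= 1 by have := hX01 i w; lra.
have mid : measurable_fun setT (fun x : R => x) by exact: measurable_id.
have s1 := variance_le hn mid hX01 hmu Imu Ivar.
(* [A1] covers a mean too low, [A3] a mean too high, and [A2] a value of [W] at mu too small. *)
have [A1 [mA1 HA1 PA1]] := sample_mean_tail hn Xind c0 mid hX01 hmu hsigma Imu Ivar.
have [A2 [mA2 HA2 PA2]] := sample_var_tail hn Xind c0 mid hX01 hmu hsigma Imu Ivar.
have [A3 [mA3 HA3 PA3]] :=
  sample_mean_tail hn Xind c0 mB1 B01 nu01 hsigma ImuB1 IvarB1.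
(* The level c is calibrated so that each bad event costs a third of delta. *)
have eE : expR (- (n%:R * c)) = delta / 3.
  have nR0 : n%:R != 0 :> R by rewrite pnatr_eq0 -lt0n.
  by rewrite /c mulrCA mulfV// mulr1 expRN lnK ?posrE ?divr_gt0// invf_div.
rewrite eE in PA1 PA2 PA3.
pose Bu := [set w | exists2 nu, nu < mu & upper_set c (z w) (v w) nu].
pose Bl := [set w | exists2 nu, nu < 1 - mu & upper_set c (1 - z w) (v w) nu].
have mz : measurable_fun setT z by exact: (measurable_sample_mean X mid).
have mv : measurable_fun setT v.
  apply: measurable_funM => //; apply: measurable_sum => i.
  by apply: measurable_funX; exact: measurable_funB.
have mBu : measurable Bu.
  by apply: measurable_upper_set_below => // w; have /andP[] := zI w.
have mBl : measurable Bl.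
  apply: measurable_upper_set_below => //; [exact: measurable_funB|lra|].
  by move=> w; rewrite subr_ge0; have /andP[] := zI w.
have -> : [set w | lower_limit delta (fun i => X i w) <= mu <=
    upper_limit delta (fun i => X i w)] = ~` (Bu `|` Bl).
  apply/seteqP; split=> w /=.
    move=> /andP[hL hU] [] h.
    - move: hU; rewrite leNgt => /negP; apply.
      exact/(upper_limit_ltP hn (hX01^~ w) hdelta hmu).
    - move: hL; rewrite leNgt => /negP; apply.
      exact/(lower_limit_gtP delta hn (hX01^~ w) hmu).
  move=> /not_orP[nBu nBl]; apply/andP; split; rewrite leNgt; apply/negP.
  - by move=> /(lower_limit_gtP delta hn (hX01^~ w) hmu).
  - by move=> /(upper_limit_ltP hn (hX01^~ w) hdelta hmu).
(* Upward closure carries nu to mu (or to 1 - mu), and theta = sigma^2 is then tested there. *)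
have sub : Bu `|` Bl `<=` A1 `|` A2 `|` A3.
  move=> w [] [nu numu hnu].
  - have := @upper_set_upclosed _ c (z w) (v w) nu mu.
    have /andP[-> _] := zI w; rewrite v0 (ltW numu) !inE => /(_ isT isT hnu isT mu1).
    move=> [/andP[zmu _] /(_ (sigma ^+ 2))]; rewrite hsigma s1 => /(_ isT).
    rewrite lt_max => /orP[h|h]; left; [left; exact: HA1|right; exact: HA2].
  - have := @upper_set_upclosed _ c (1 - z w) (v w) nu (1 - mu).
    rewrite subr_ge0; have /andP[_ ->] := zI w.
    rewrite v0 (ltW numu) !inE => /(_ isT isT hnu isT).
    move=> /(_ ltac:(lra)) [/andP[zmu _] /(_ (sigma ^+ 2))].
    rewrite hsigma (_ : (1 - mu) * _ = mu * (1 - mu)); last by ring.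
    rewrite s1 => /(_ isT); rewrite lt_max => /orP[h|h].
      by right; apply: HA3; rewrite sample_meanB1.
    (* [A2] serves both sides, since the squared bias is invariant under reflection. *)
    left; right; apply: HA2; move: h.
    by rewrite (_ : 1 - z w - (1 - mu) = - (z w - mu)) ?sqrrN//; ring.
have mB : measurable (Bu `|` Bl) by exact: measurableU.
have mA12 : measurable (A1 `|` A2) by exact: measurableU.
have mA : measurable (A1 `|` A2 `|` A3) by exact: measurableU.
have PB : (P (Bu `|` Bl) <= delta%:E)%E.
  apply: (@le_trans _ _ (P (A1 `|` A2 `|` A3))); first by rewrite le_measure ?inE.
  apply: (le_trans (measureU2 _ mA12 mA3)).
  rewrite (_ : delta%:E = (delta / 3)%:E + (delta / 3)%:E + (delta / 3)%:E)%E.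
    apply: leeD => //; apply: (le_trans (measureU2 _ mA1 mA2)); exact: leeD.
  by rewrite -!EFinD; congr (_%:E); field.
by rewrite probability_setC// EFinB leeB.
Qed.
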